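(* Let $P\subset\mathbb R^d$ be a rational $d$-polytope with $-P=P+\bm u$ for some $\bm u\in\mathbb Z^d$, and let $C$ be a $d$-dimensional cell of $\Delta_P/\mathbb Z^d$. For $k\in\mathbb Z$, let $f(t)$ be the $k$th constituent and $g(t)$ the $(-k)$th constituent of the quasi-polynomial $\mathrm{TL}_{P,C}$. Then $f(t)=(-1)^d g(-t)$.
   Context: $P=\bigcap_{i=1}^m\{\bm x:(\bm a_i,\bm x)\ge b_i\}$ irredundantly, $(\bm a_i,b_i)\in\mathbb Z^{d+1}$ primitive; $\Delta_P$ is the decomposition of $\mathbb R^d$ into open cells by the hyperplanes $(\bm a_i,\bm x)=k$ ($k\in\mathbb Z$), and $\Delta_P/\mathbb Z^d$ its image in $\mathbb R^d/\mathbb Z^d$. $\mathrm{TL}_{P,C}:=\mathrm{TL}_{P,\bm v}$ for any $\bm v$ with $[\bm v]\in C$, where $\mathrm{TL}_{P,\bm v}(t)=\#((tP+\bm v)\cap\mathbb Z^d)$, a quasi-polynomial. The $k$th constituent for $k\in\mathbb Z$ is the polynomial agreeing with it on $t\equiv k$ modulo a period. *)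

(* Defs.v *)
From mathcomp Require Import all_boot all_order all_algebra.
From mathcomp Require Import finmap.
From mathcomp Require Import boolp classical_sets cardinality reals.
Set Implicit Arguments. Unset Strict Implicit. Unset Printing Implicit Defensive.
Import Order.TTheory GRing.Theory Num.Theory.
Local Open Scope classical_set_scope.
Local Open Scope ring_scope.

Section Defs.
Variables (R : realType) (d m : nat).

Definition intpt (z : 'rV[int]_d) : 'rV[R]_d := map_mx (fun c : int => c%:~R) z.

Definition dotZ (a : 'rV[int]_d) (x : 'rV[R]_d) : R :=
  \sum_(j < d) (a ord0 j)%:~R * x ord0 j.

Definition ineqPolytope (a : 'I_m -> 'rV[int]_d) (b : 'I_m -> int) : set 'rV[R]_d :=
  [set x | forall i, (b i)%:~R <= dotZ (a i) x].

Definition primitive_vec (a : 'rV[int]_d) (c : int) : Prop :=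
  forall e : int, (forall j, (e %| a ord0 j)%Z) -> (e %| c)%Z -> e = 1 \/ e = -1.

Definition irredundant (a : 'I_m -> 'rV[int]_d) (b : 'I_m -> int) : Prop :=
  forall i, exists x : 'rV[R]_d,
    (forall j, j != i -> (b j)%:~R <= dotZ (a j) x) /\ dotZ (a i) x < (b i)%:~R.

Definition has_interior (S : set 'rV[R]_d) : Prop :=
  exists x : 'rV[R]_d, exists e : R, 0 < e /\
    forall y : 'rV[R]_d, (forall j, `|y ord0 j - x ord0 j| < e) -> S y.

Definition bounded_set (S : set 'rV[R]_d) : Prop :=
  exists M : R, forall x, S x -> forall j, `|x ord0 j| <= M.

(* a d-polytope: bounded and d-dimensional (rationality is automatic from integer data) *)
Definition d_polytope (S : set 'rV[R]_d) : Prop := bounded_set S /\ has_interior S.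

Definition same_cell (a : 'I_m -> 'rV[int]_d) (x y : 'rV[R]_d) : Prop :=
  forall i (k : int),
    (dotZ (a i) x < k%:~R <-> dotZ (a i) y < k%:~R) /\
    (dotZ (a i) x = k%:~R <-> dotZ (a i) y = k%:~R).

Definition is_cell (a : 'I_m -> 'rV[int]_d) (C : set 'rV[R]_d) : Prop :=
  exists x, C = [set y | same_cell a x y].

Definition TL (a : 'I_m -> 'rV[int]_d) (b : 'I_m -> int) (v : 'rV[R]_d) (t : nat) : nat :=
  #|` fset_set [set z : 'rV[int]_d |
      exists y, ineqPolytope a b y /\ intpt z - v = t%:R *: y] |%fset.

Definition qpoly_period (F : nat -> nat) (N : nat) : Prop :=
  (0 < N)%N /\ forall r : int, exists p : {poly R},
    forall t : nat, (0 < t)%N -> (t%:Z = r %[mod N%:Z])%Z -> p.[t%:R] = (F t)%:R.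

Definition constituent (F : nat -> nat) (N : nat) (k : int) (p : {poly R}) : Prop :=
  forall t : nat, (0 < t)%N -> (t%:Z = k %[mod N%:Z])%Z -> p.[t%:R] = (F t)%:R.

End Defs.

(* Main.v *)
Require Import Defs.
From mathcomp Require Import all_boot all_order all_algebra.
From mathcomp Require Import finmap.
From mathcomp Require Import boolp classical_sets cardinality reals.
From mathcomp Require Import zify ring lra.
Set Implicit Arguments. Unset Strict Implicit. Unset Printing Implicit Defensive.
Import Order.TTheory GRing.Theory Num.Theory.
Local Open Scope classical_set_scope.
Local Open Scope ring_scope.

(* Reciprocity for generic translates.  The points of tP + v are those of a
   homogeneous cone in the variables (t, z - v).  Summing the indicator of the
   cone over one coordinate of z at a time (Fourier-Motzkin elimination) gives
   quasi-polynomials times indicators of cones in fewer variables.  Do the same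
   with every inequality reversed: since
     sum_(A < y <= B) q y = Q B - Q A   and   sum_(B < y <= A) q y = Q A - Q B
   for Q a discrete antiderivative of q, each elimination changes only the sign
   of the quasi-polynomial.  After d steps only inequalities on the sign of t
   remain, so one quasi-polynomial equals the count for t > 0 and (-1)^d times
   the count of the reversed system for t < 0.  As v is generic and -P = P + u,
   reversing the inequalities and the sign of t returns the original count. *)

(** * Signed sums over the integers and sums over half-open intervals *)

Section IntegerSums.
Variable R : realType.
Implicit Types (g h : int -> R) (x y : int).

(** The discrete antiderivative of [g] that vanishes at 0. For negative [x] it is minus the sum over
    x < y <= 0, so that the difference equation also holds across 0. *)
Definition sgsum g x : R :=
  match x with
  | Posz m => \sum_(i < m) g (i.+1)%:Z
  | Negz m => - \sum_(i < m.+1) g (- i%:Z)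
  end.

Lemma sgsum0 g : sgsum g 0 = 0.
Proof. by rewrite /= big_ord0. Qed.

Lemma sgsumS g x : sgsum g (x + 1) = sgsum g x + g (x + 1).
Proof.
case: x => m.
  have -> : Posz m + 1 = Posz m.+1 by rewrite -addn1.
  by rewrite /sgsum big_ord_recr.
case: m => [|m].
  have -> : Negz 0 + 1 = 0 by [].
  by rewrite sgsum0 /= big_ord1 oppr0 addNr.
have -> : Negz m.+1 + 1 = Negz m by lia.
rewrite /sgsum [in RHS]big_ord_recr /= opprD.
have -> : - m.+1%:Z = Negz m by lia.
by rewrite subrK.
Qed.

(** Two-sided induction in a form suited to antiderivatives: their identities reduce to the value at
    0 and to first differences. *)
Lemma int_function_unique (H1 H2 : int -> R) :
  H1 0 = H2 0 -> (forall x, H1 (x + 1) - H1 x = H2 (x + 1) - H2 x) ->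
  H1 =1 H2.
Proof.
move=> h0 hS; elim/int_rect => [//|m ih|m ih].
  have := hS m%:Z; rewrite ih -addn1 PoszD; move/(congr1 (+%R^~ (H2 m))).
  by rewrite !subrK.
have := hS (- m.+1%:Z).
have -> : - m.+1%:Z + 1 = - m%:Z by lia.
by rewrite ih => /addrI /oppr_inj.
Qed.

Lemma sgsumB g h x : sgsum (fun y => g y - h y) x = sgsum g x - sgsum h x.
Proof.
move: x; apply: int_function_unique => [|x]; first by rewrite !sgsum0 subrr.
by rewrite !sgsumS; ring.
Qed.

Lemma sgsum_shift g x y :
  sgsum g (x + y) = sgsum (fun z => g (z + y)) x + sgsum g y.
Proof.
move: x; apply: int_function_unique => [|x]; first by rewrite sgsum0 !add0r.
have -> : x + 1 + y = (x + y) + 1 by ring.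
by rewrite !sgsumS (_ : x + 1 + y = x + y + 1); ring.
Qed.

Lemma sum_interval g (s a b : int) (K : nat) :
  a <= b -> (forall y, a < y -> y <= b -> s <= y < s + K%:Z) ->
  \sum_(i < K) g (s + i%:Z) * ((a < s + i%:Z) && (s + i%:Z <= b))%:R
  = sgsum g b - sgsum g a.
Proof.
rewrite le_eqVlt => /orP[/eqP <- _|ab hab].
  rewrite subrr big1// => i _; rewrite ltNge; case: leP => _; by rewrite mulr0.
have /andP[sa _] : s <= a + 1 < s + K%:Z by apply: hab; lia.
have /andP[_ bs] : s <= b < s + K%:Z by apply: hab; lia.
(* [clamp] projects onto [a, b]. The antiderivative composed with it grows by [g y] on (a, b] and is
   constant elsewhere, so the sum over the whole window telescopes. *)
pose clamp y := Num.max a (Num.min b y).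
have step y : sgsum g (clamp y) - sgsum g (clamp (y - 1)) =
    g y * ((a < y) && (y <= b))%:R.
  rewrite /clamp; case: (boolP (a < y)) => ay; last first.
    rewrite mulr0.
    have -> : Num.max a (Num.min b y) = a by lia.
    have -> : Num.max a (Num.min b (y - 1)) = a by lia.
    by rewrite subrr.
  case: (boolP (y <= b)) => yb; last first.
    rewrite mulr0.
    have -> : Num.max a (Num.min b y) = b by lia.
    have -> : Num.max a (Num.min b (y - 1)) = b by lia.
    by rewrite subrr.
  have -> : Num.max a (Num.min b y) = (y - 1) + 1 by lia.
  have -> : Num.max a (Num.min b (y - 1)) = y - 1 by lia.
  by rewrite sgsumS addrAC subrr add0r mulr1 subrK.
transitivity (sgsum g (clamp (s + K%:Z - 1)) - sgsum g (clamp (s - 1))).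
  elim: K {hab bs} => [|K ih]; first by rewrite big_ord0 addr0 subrr.
  rewrite big_ord_recr /= {}ih -step.
  have -> : s + K.+1%:Z - 1 = s + K%:Z by lia.
  ring.
by congr (sgsum _ _ - sgsum _ _); rewrite /clamp; lia.
Qed.

End IntegerSums.

(** * Quasi-polynomials in several variables, described by iterated differences *)

Section QuasiPolynomials.
Variables (R : realType) (n : nat).
Local Notation point := 'rV[int]_n.
Implicit Types (h q : point -> R) (e v : point) (k : 'I_n) (y : int).

Definition upd e k y : point := \row_j (if j == k then y else e ord0 j).

Lemma upd_same e k y : upd e k y ord0 k = y.
Proof. by rewrite mxE eqxx. Qed.

Lemma upd_other e k y j : j != k -> upd e k y ord0 j = e ord0 j.
Proof. by rewrite mxE => /negPf ->. Qed.

Lemma upd_upd e k y z : upd (upd e k y) k z = upd e k z.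
Proof. by apply/rowP => j; rewrite !mxE; case: eqP. Qed.

Lemma updD e v k y z : upd e k y + upd v k z = upd (e + v) k (y + z).
Proof. by apply/rowP => j; rewrite !mxE; case: eqP. Qed.

Lemma updZ c v k z : c *: upd v k z = upd (c *: v) k (c * z).
Proof. by apply/rowP => j; rewrite !mxE; case: eqP. Qed.

(* [h] is a polynomial on each coset of [W Z^n] iff its [D]-fold differences
   along [W Z^n] vanish for some [D]. *)
Fixpoint dnilp (W : int) (D : nat) h : Prop :=
  if D is D'.+1 then forall v, dnilp W D' (fun e => h (e + W *: v) - h e)
  else forall e, h e = 0.

Definition quasi_poly h : Prop := exists W D, 0 < W /\ dnilp W D h.

Lemma dnilp_ext W D h q : h =1 q -> dnilp W D h -> dnilp W D q.
Proof.
elim: D h q => [|D ih] h q hq /= hh; first by move=> e; rewrite -hq.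
by move=> v; apply: ih (hh v) => e; rewrite !hq.
Qed.

Lemma dnilp0 W D : dnilp W D (fun=> 0).
Proof.
elim: D => [//|D ih] /= v; apply: dnilp_ext ih => e; by rewrite subrr.
Qed.

Lemma dnilp_leq W D D' h : (D <= D')%N -> dnilp W D h -> dnilp W D' h.
Proof.
elim: D' D h => [|D' ih] [|D] h //= leD hh v.
  by apply: dnilp_ext (dnilp0 _ _) => e; rewrite !hh subrr.
exact: ih (hh v).
Qed.

Lemma dnilpN W D h : dnilp W D h -> dnilp W D (fun e => - h e).
Proof.
elim: D h => [|D ih] h /= hh; first by move=> e; rewrite hh oppr0.
by move=> v; apply: dnilp_ext (ih _ (hh v)) => e; rewrite opprB opprK addrC.
Qed.

Lemma dnilpD W D h q : dnilp W D h -> dnilp W D q -> dnilp W D (fun e => h e + q e).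
Proof.
elim: D h q => [|D ih] h q /= hh hq; first by move=> e; rewrite hh hq addr0.
by move=> v; apply: dnilp_ext (ih _ _ (hh v) (hq v)) => e; rewrite opprD addrACA.
Qed.

Lemma dnilpB W D h q : dnilp W D h -> dnilp W D q -> dnilp W D (fun e => h e - q e).
Proof. by move=> hh hq; apply: dnilpD hh (dnilpN hq). Qed.

Lemma dnilpZ W D (c : R) h : dnilp W D h -> dnilp W D (fun e => c * h e).
Proof.
elim: D h => [|D ih] h /= hh; first by move=> e; rewrite hh mulr0.
by move=> v; apply: dnilp_ext (ih _ (hh v)) => e; rewrite mulrBr.
Qed.

Lemma dnilp_cst W (c : R) : dnilp W 1 (fun=> c).
Proof. by move=> v e; rewrite subrr. Qed.

Lemma dnilp_sum W D m (h : 'I_m -> point -> R) :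
  (forall i, dnilp W D (h i)) -> dnilp W D (fun e => \sum_i h i e).
Proof.
elim: m h => [|m ih] h hh.
  by apply: dnilp_ext (dnilp0 _ _) => e; rewrite big_ord0.
apply: dnilp_ext (dnilpD (ih _ (fun i => hh (widen_ord (leqnSn m) i))) (hh ord_max)) => e.
by rewrite big_ord_recr.
Qed.

(** A substitution turning steps along [W' Z^n] into steps along [W Z^n], with increments
    independent of the base point, commutes with differencing. *)
Lemma dnilp_pullback W W' D h (g lin : point -> point) :
  (forall e v, g (e + W' *: v) = g e + W *: lin v) ->
  dnilp W D h -> dnilp W' D (h \o g).
Proof.
move=> hg; elim: D h => [|D ih] h /= hh; first by move=> e; rewrite hh.
by move=> v; apply: dnilp_ext (ih _ (hh (lin v))) => e /=; rewrite hg.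
Qed.

Lemma dnilp_mull W W' D h : dnilp W D h -> dnilp (W' * W) D h.
Proof.
apply: (@dnilp_pullback _ _ _ _ id (fun v => W' *: v)) => e v.
by rewrite scalerA mulrC.
Qed.

Lemma quasi_poly_ext h q : h =1 q -> quasi_poly h -> quasi_poly q.
Proof. by move=> hq [W [D [W0 hh]]]; exists W, D; split=> //; apply: dnilp_ext hh. Qed.

Lemma quasi_poly_cst (c : R) : quasi_poly (fun=> c).
Proof. by exists 1, 1%N; split=> //; apply: dnilp_cst. Qed.

Lemma quasi_polyN h : quasi_poly h -> quasi_poly (fun e => - h e).
Proof. by move=> [W [D [W0 hh]]]; exists W, D; split=> //; apply: dnilpN. Qed.

Lemma quasi_polyD h q :
  quasi_poly h -> quasi_poly q -> quasi_poly (fun e => h e + q e).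
Proof.
move=> [W [D [W0 hh]]] [W' [D' [W'0 hq]]].
exists (W' * W), (maxn D D'); split; first exact: mulr_gt0.
apply: dnilpD; first by apply: dnilp_mull; apply: dnilp_leq hh; rewrite leq_maxl.
by rewrite mulrC; apply: dnilp_mull; apply: dnilp_leq hq; rewrite leq_maxr.
Qed.

Lemma quasi_polyB h q :
  quasi_poly h -> quasi_poly q -> quasi_poly (fun e => h e - q e).
Proof. by move=> hh hq; apply: quasi_polyD hh (quasi_polyN hq). Qed.

Definition antidiff k q e : R := sgsum (fun y => q (upd e k y)) (e ord0 k).

Lemma dnilp_upd W D q k y v :
  dnilp W D q -> dnilp W D (fun e => q (upd (e + v) k y)).
Proof.
apply: (@dnilp_pullback _ _ _ _ (fun e => upd (e + v) k y) (fun v => upd v k 0)).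
by move=> e w; rewrite updZ updD mulr0 addr0 addrAC.
Qed.

Lemma dnilp_sgsum W D q k y v :
  dnilp W D q -> dnilp W D (fun e => sgsum (fun z => q (upd (e + v) k z)) y).
Proof.
move=> hq; case: y => m; last apply: dnilpN.
all: by apply: dnilp_sum => i; apply: dnilp_upd.
Qed.

(** Differencing along [W *: v] gives the antidifference of a difference of [q], covered by
    induction, plus a signed sum with the constant limit [c], which is a finite combination of
    copies of [q] with coordinate [k] frozen. *)
Lemma dnilp_antidiff W D k q : dnilp W D q -> dnilp W D.+1 (antidiff k q).
Proof.
elim: D q => [|D ih] q hq v.
  have h0 e : antidiff k q e = 0.
    have sg0 : sgsum (fun z => q (upd e k z)) =1 fun=> 0.
      by apply: int_function_unique => [|x]; rewrite ?sgsum0// sgsumS hq addr0 !subrr.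
    exact: sg0.
  by move=> e; rewrite !h0 subrr.
pose c := W * v ord0 k.
apply: dnilp_ext (dnilpD (ih _ (hq v)) (@dnilp_sgsum W D.+1 q k c (W *: v) hq)) => e.
rewrite /antidiff sgsumB [(e + _) _ _]mxE [(_ *: v) _ _]mxE -/c sgsum_shift.
rewrite addrAC; congr (sgsum _ _ + _ - _); apply: funext => y.
by congr q; apply/rowP => j; rewrite !mxE; case: eqP => // ->.
Qed.

Lemma quasi_poly_antidiff k q : quasi_poly q -> quasi_poly (antidiff k q).
Proof. by move=> [W [D [W0 hq]]]; exists W, D.+1; split=> //; apply: dnilp_antidiff. Qed.

(** [A] stands for a rounded bound with denominator [mu]. It is additive only along multiples of
    [mu], and enlarging the modulus by that factor absorbs the rounding. *)
Lemma quasi_poly_upd k q (A lin : point -> int) (mu : int) : 0 < mu ->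
  (forall e v, A (e + mu *: v) = A e + lin v) ->
  (forall c v, lin (c *: v) = c * lin v) ->
  quasi_poly q -> quasi_poly (fun e => q (upd e k (A e))).
Proof.
move=> mu0 hA hlin [W [D [W0 hq]]]; exists (mu * W), D; split; first exact: mulr_gt0.
apply: (@dnilp_pullback W _ D q (fun e => upd e k (A e))
          (fun v => upd (mu *: v) k (lin v))) hq => e v.
by rewrite updZ updD -scalerA hA hlin !scalerA mulrC.
Qed.

(** Induction on [D]: the difference along the line vanishes far out, hence everywhere, so [h] is
    constant on the line and equal to its value at [T]. This carries identities from positive to
    negative dilation factors. *)
Lemma dnilp_line_eq0 W D h e v (T : int) : dnilp W D h ->
  (forall s : int, T <= s -> h (e + (s * W) *: v) = 0) ->
  forall s : int, h (e + (s * W) *: v) = 0.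
Proof.
elim: D h => [|D ih] h hh hT s; first exact: hh.
have step x : h (e + ((x + 1) * W) *: v) = h (e + (x * W) *: v).
  apply/eqP; rewrite -subr_eq0; apply/eqP.
  rewrite mulrDl mul1r scalerDl addrA.
  move: x; apply: ih (hh v) _ => x Tx.
  rewrite -addrA -scalerDl -{2}(mul1r W) -mulrDl !hT ?subrr//; lia.
have : (fun x : int => h (e + (x * W) *: v)) =1 (fun=> h (e + (0 * W) *: v)).
  by apply: int_function_unique => // x; rewrite step !subrr.
move=> H; rewrite (H s) -(H T); exact: hT.
Qed.

Lemma dnilp_poly (p : {poly R}) (k : 'I_n) W :
  dnilp W (size p) (fun e => p.[(e ord0 k)%:~R]).
Proof.
(* By the discrete Leibniz rule, multiplication by a coordinate costs one more difference. *)
have mulX D h : dnilp W D h -> dnilp W D.+1 (fun e => (e ord0 k)%:~R * h e).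
  elim: D h => [|D ih] h hh v.
    by move=> e; rewrite !hh !mulr0 subrr.
  have hv := hh v; have hv' := dnilp_leq (leqnSn D) hv.
  apply: dnilp_ext (dnilpD (ih _ hv)
    (dnilpZ (W * v ord0 k)%:~R (dnilpD hh hv'))) => e.
  by rewrite [(e + _) _ _]mxE [(_ *: v) _ _]mxE intrD; ring.
elim/poly_ind: p => [|p c ih].
  by rewrite size_poly0 => e; rewrite horner0.
rewrite size_MXaddC; case: ifP => [/andP[/eqP -> /eqP ->]|_].
  by move=> e; rewrite mul0r add0r hornerC.
apply: dnilp_ext (dnilpD (mulX _ _ ih) (dnilp_leq (ltn0Sn _) (dnilp_cst W c))) => e.
by rewrite hornerMXaddC mulrC.
Qed.

End QuasiPolynomials.

(** * Signs of affine forms with ties broken, and their integer thresholds *)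

Section LinearForms.
Variables (R : realType) (n : nat) (w : 'rV[R]_n).
Implicit Types (a b c : 'rV[int]_n) (e v : 'rV[int]_n) (k : 'I_n) (x y : int).

(** The sign of [c] on a vector of positive infinitesimals, each negligible against the preceding
    one. It holds for exactly one of [c] and [- c] when [c] is nonzero. *)
Definition lexpos c :=
  [exists j, (0 < c ord0 j) && [forall i : 'I_n, (i < j)%N ==> (c ord0 i == 0)]].

Definition sform c e : R := \sum_j (c ord0 j)%:~R * ((e ord0 j)%:~R - w ord0 j).

(* Ties are broken as if [w] were perturbed by infinitesimals of decreasing order. *)
Definition lpos c e := (0 < sform c e) || (sform c e == 0) && lexpos c.

Lemma lposE c e : lpos c e = (0 < sform c e) || (sform c e == 0) && lexpos c.
Proof. by []. Qed.

Lemma lpos_ge0 c e : lpos c e -> 0 <= sform c e.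
Proof. by rewrite lposE => /orP[/ltW//|/andP[/eqP -> _]]. Qed.

Lemma lposN_le0 c e : ~~ lpos c e -> sform c e <= 0.
Proof. by rewrite lposE negb_or -leNgt => /andP[]. Qed.

Lemma lexposP c :
  reflect (exists2 j, 0 < c ord0 j & forall i : 'I_n, (i < j)%N -> c ord0 i = 0)
          (lexpos c).
Proof.
apply: (iffP existsP) => [[j /andP[cj /forallP h]]|[j cj h]]; exists j => //.
  by move=> i ij; apply/eqP; have := h i; rewrite ij.
by rewrite cj; apply/forallP => i; apply/implyP => /h ->.
Qed.

Lemma lexpos_comb a b x y : 0 < x -> 0 < y ->
  lexpos a -> lexpos b -> lexpos (x *: a + y *: b).
Proof.
move=> x0 y0 /lexposP[i ai hi] /lexposP[j bj hj]; apply/lexposP.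
have [ij|ji|ij] := ltngtP i j.
- exists i => [|h hhi]; rewrite !mxE.
    by rewrite hj// mulr0 addr0 mulr_gt0.
  by rewrite hi// hj ?(ltn_trans hhi)// !mulr0 addr0.
- exists j => [|h hhj]; rewrite !mxE.
    by rewrite hi// mulr0 add0r mulr_gt0.
  by rewrite hj// hi ?(ltn_trans hhj)// !mulr0 addr0.
- exists i => [|h hhi]; rewrite !mxE.
    by rewrite (val_inj ij) addr_gt0 ?mulr_gt0// -(val_inj ij).
  by rewrite hi// hj -?ij// !mulr0 addr0.
Qed.

Lemma lexpos0 : lexpos 0 = false.
Proof. by apply/lexposP => -[j]; rewrite mxE ltxx. Qed.

Lemma lexposN c : c != 0 -> lexpos (- c) = ~~ lexpos c.
Proof.
move=> c0; have [cp|cnp] := boolP (lexpos c).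
  apply/negbTE/negP => cn.
  have := @lexpos_comb _ _ 1 1 ltr01 ltr01 cp cn.
  by rewrite !scale1r subrr lexpos0.
have [j0 cj0] : exists j, c ord0 j != 0.
  apply/existsP; apply: contraNT c0; rewrite negb_exists => /forallP h.
  by apply/eqP/rowP => j; rewrite mxE; apply/eqP; rewrite -[_ == _]negbK h.
case: (@arg_minnP _ j0 (fun j => c ord0 j != 0) val cj0) => j cj hj.
have small (i : 'I_n) : (i < j)%N -> c ord0 i = 0.
  by move=> ij; apply/eqP; apply: contraTT ij => /hj; rewrite -leqNgt.
apply/lexposP; exists j; last by move=> i /small h; rewrite mxE h oppr0.
rewrite mxE oppr_gt0 lt_neqAle cj /= leNgt; apply: contra cnp => cj'.
by apply/lexposP; exists j.
Qed.

Lemma sform_comb a b x y e :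
  sform (x *: a + y *: b) e = x%:~R * sform a e + y%:~R * sform b e.
Proof.
rewrite /sform !mulr_sumr -big_split; apply: eq_bigr => j _ /=.
by rewrite !mxE intrD !intrM; ring.
Qed.

Lemma sformN c e : sform (- c) e = - sform c e.
Proof. by rewrite -sumrN; apply: eq_bigr => j _; rewrite mxE intrN mulNr. Qed.

Lemma sform0 e : sform 0 e = 0.
Proof. by apply: big1 => j _; rewrite mxE mul0r. Qed.

Lemma lpos0 e : lpos 0 e = false.
Proof. by rewrite /lpos sform0 ltxx lexpos0 andbF. Qed.

Lemma lpos_comb a b x y e : 0 < x -> 0 < y ->
  lpos a e -> lpos b e -> lpos (x *: a + y *: b) e.
Proof.
move=> x0 y0; rewrite /lpos sform_comb.
have xR : 0 < x%:~R :> R by rewrite ltr0z.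
have yR : 0 < y%:~R :> R by rewrite ltr0z.
move=> /orP[pa|/andP[/eqP -> la]] /orP[pb|/andP[/eqP -> lb]].
- by rewrite addr_gt0 ?mulr_gt0.
- by rewrite mulr0 addr0 mulr_gt0.
- by rewrite mulr0 add0r mulr_gt0.
- by rewrite !mulr0 addr0 eqxx lexpos_comb// orbT.
Qed.

(** The purpose of the tie-breaking: reversing an inequality is exactly negating it, even where the
    form vanishes. *)
Lemma lposN c e : c != 0 -> lpos (- c) e = ~~ lpos c e.
Proof.
move=> c0; rewrite /lpos sformN oppr_gt0 oppr_eq0 lexposN// negb_or negb_and.
by case: ltgtP.
Qed.

Lemma lposZ c x e : 0 < x -> lpos (x *: c) e = lpos c e.
Proof.
move=> x0; have [->|c0] := eqVneq c 0; first by rewrite scaler0.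
have imp b : lpos b e -> lpos (x *: b) e.
  (* [lpos_comb] wants two positive coefficients, hence this splitting and the separate case
     [x = 1]. *)
  have -> : x *: b = (x - 1 + 1) *: b by rewrite subrK.
  have [->|x1] := eqVneq x 1; first by rewrite subrr add0r scale1r.
  by move=> pb; rewrite scalerDl lpos_comb//; lia.
have [/imp ->//|pc] := boolP (lpos c e).
have : lpos (- c) e by rewrite lposN.
have xc0 : x *: c != 0.
  move: (c0); apply: contra => /eqP/rowP xc; apply/eqP/rowP => j; apply/eqP.
  by have /eqP := xc j; rewrite !mxE mulf_eq0 gt_eqF.
by move/imp; rewrite scalerN lposN// => /negPf.
Qed.

(** As x c = y a + d0, positivity of [d0] makes [a] imply [c], and its failure makes [c] imply [a].
    The sign of [d0] thus selects the stronger of two bounds; by contraposition it selects the other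
    one among their negations. *)
Lemma lpos_split a c d0 x y e : a != 0 -> c != 0 -> d0 != 0 -> 0 < x -> 0 < y ->
  d0 = x *: c - y *: a ->
  (lpos a e && lpos c e = if lpos d0 e then lpos a e else lpos c e) *
  (~~ lpos a e && ~~ lpos c e = if lpos d0 e then ~~ lpos c e else ~~ lpos a e).
Proof.
move=> a0 c0 d00 x0 y0 hd.
have hc : lpos d0 e -> lpos a e -> lpos c e.
  move=> pd pa; rewrite -(lposZ _ _ x0) -[x *: c](subrK (y *: a)) -hd.
  by rewrite -[d0]scale1r lpos_comb.
have ha : ~~ lpos d0 e -> lpos c e -> lpos a e.
  rewrite -lposN// => pd pa; rewrite -(lposZ _ _ y0).
  have -> : y *: a = 1 *: (- d0) + x *: c by rewrite hd scale1r opprB subrK.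
  by rewrite lpos_comb.
by move: hc ha; case: (lpos a e); case: (lpos c e); case: (lpos d0 e) => h1 h2;
  split=> //; first [by have := h1 isT isT | by have := h2 isT isT].
Qed.

Lemma sform_upd c e k y :
  sform c (upd e k y) = sform c e + (c ord0 k)%:~R * (y%:~R - (e ord0 k)%:~R).
Proof.
rewrite /sform (bigD1 k)//= [in RHS](bigD1 k)//= upd_same addrAC -mulrDr.
congr (_ * _ + _); first ring.
by apply: eq_bigr => j jk; rewrite upd_other.
Qed.

Lemma lpos_upd c e k y : c ord0 k = 0 -> lpos c (upd e k y) = lpos c e.
Proof. by move=> ck; rewrite /lpos sform_upd ck mul0r addr0. Qed.

Lemma sformD c e v :
  sform c (e + v) = sform c e + (\sum_j c ord0 j * v ord0 j)%:~R.
Proof.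
rewrite /sform rmorph_sum -big_split; apply: eq_bigr => j _ /=.
by rewrite mxE intrD intrM; ring.
Qed.

(** Solving for coordinate [k]: the form is a positive multiple of y - r, so it is positive when y >
    floor r, or when y > ceil r - 1 if ties count as positive. A step along [c ord0 k *: v] moves r
    by an integer, which passes through the rounding. *)
Lemma lpos_threshold c k : 0 < c ord0 k -> exists A lin : 'rV[int]_n -> int,
  [/\ forall e y, lpos c (upd e k y) = (A e < y),
      forall e v, A (e + c ord0 k *: v) = A e + lin v &
      forall x v, lin (x *: v) = x * lin v].
Proof.
set K := c ord0 k => K0; have KR : 0 < K%:~R :> R by rewrite ltr0z.
pose r e : R := (e ord0 k)%:~R - sform c e / K%:~R.
pose lin v := K * v ord0 k - \sum_j c ord0 j * v ord0 j.
have formE e y : sform c (upd e k y) = K%:~R * (y%:~R - r e).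
  by rewrite sform_upd -/K /r; field; rewrite gt_eqF.
have rD e v : r (e + K *: v) = r e + (lin v)%:~R.
  rewrite /r sformD !mxE /lin intrB intrD intrM.
  have -> : \sum_j c ord0 j * (K *: v) ord0 j = K * \sum_j c ord0 j * v ord0 j.
    by rewrite mulr_sumr; apply: eq_bigr => j _; rewrite mxE; ring.
  by rewrite intrM; field; rewrite gt_eqF.
have linZ x v : lin (x *: v) = x * lin v.
  rewrite /lin mulrBr mulr_sumr mxE; congr (_ - _); first ring.
  by apply: eq_bigr => j _; rewrite mxE; ring.
have [lc|lc] := boolP (lexpos c).
  exists (fun e => Num.ceil (r e) - 1), lin; split => // [e y|e v].
    rewrite /lpos formE lc andbT pmulr_rgt0// mulf_eq0 gt_eqF//= subr_gt0 subr_eq0.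
    by rewrite eq_sym orbC -le_eqVlt -ceil_le_int ltrBlDr ltzD1.
  by rewrite rD ceilDrz ?intr_int// intrKceil addrAC.
exists (fun e => Num.floor (r e)), lin; split => // [e y|e v].
  rewrite /lpos formE (negPf lc) andbF orbF pmulr_rgt0// subr_gt0.
  by rewrite floor_lt_int.
by rewrite rD floorDrz ?intr_int// intrKfloor.
Qed.

End LinearForms.

(** * Fourier-Motzkin elimination of coordinates from a system and its reversal *)

Section Elimination.
Variables (R : realType) (d : nat) (w : 'rV[R]_d.+1) (M V : nat).
Hypothesis w0 : w ord0 ord0 = 0.
Hypothesis wV : forall j, `|w ord0 j| <= V%:R.
Local Notation point := 'rV[int]_d.+1.
Local Notation lpos := (lpos w).
Implicit Types (a c l u : point) (e v : point) (k : 'I_d.+1) (y : int).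
Implicit Types (q phi psi : point -> R) (s : nat) (G : seq point).

(* Coordinate 0 is the dilation factor [t]; the two boxes of [k] say [|e k - w k| <= M t]. *)
Definition box k (b : bool) : point :=
  \row_i (if i == ord0 then M%:Z else if i == k then (-1) ^+ b else 0).

(** It depends on coordinate 0 alone, through its absolute value, so it survives every elimination
    and serves both signs of the dilation factor. *)
Definition radius e : nat := (M * `|e ord0 ord0| + V)%N.

Definition boxsum k phi e : R :=
  \sum_(i < (radius e).*2.+1) phi (upd e k (- (radius e)%:Z + i%:Z)).

Definition all_pos G e := all (fun c => lpos c e) G.
Definition all_neg G e := all (fun c => ~~ lpos c e) G.

(** [s] counts the coordinates still present, the dilation factor included. Zero forms are excluded
    because [lposN] fails for them. *)
Definition live s c :=
  (c != 0) && [forall j : 'I_d.+1, (s <= j)%N ==> (c ord0 j == 0)].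

Definition has_boxes s G :=
  forall k b, (0 < k < s)%N -> box k b \in G.

(* [psi] is [phi] with all inequalities reversed: the involution behind reciprocity. *)
Inductive dual_pair s : (point -> R) -> (point -> R) -> Prop :=
| dual_zero phi psi : phi =1 (fun=> 0) -> psi =1 (fun=> 0) -> dual_pair s phi psi
| dual_term q G phi psi : quasi_poly q -> all (live s) G -> has_boxes s G ->
    (forall e, phi e = q e * (all_pos G e)%:R) ->
    (forall e, psi e = q e * (all_neg G e)%:R) -> dual_pair s phi psi
| dual_add phi1 psi1 phi2 psi2 phi psi :
    dual_pair s phi1 psi1 -> dual_pair s phi2 psi2 ->
    (forall e, phi e = phi1 e + phi2 e) -> (forall e, psi e = psi1 e + psi2 e) ->
    dual_pair s phi psi.

Lemma sform_box k b e : k != ord0 ->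
  sform w (box k b) e = M%:R * (e ord0 ord0)%:~R
    + (-1) ^+ b * ((e ord0 k)%:~R - w ord0 k).
Proof.
move=> k0; rewrite /sform (bigD1 ord0)//= (bigD1 k)//= big1 ?addr0.
  rewrite !mxE eqxx (negPf k0) eqxx w0 subr0 -pmulrn; congr (_ + _ * _).
  by case: b.
by move=> j /andP[j0 jk]; rewrite mxE (negPf j0) (negPf jk) mul0r.
Qed.

(** The two boxes say |e k - w k| <= M t, and reversed they say |e k - w k| <= - M t; either way the
    window of [boxsum] contains the coordinate. *)
Lemma box_le k e : k != ord0 ->
  0 <= sform w (box k true) e /\ 0 <= sform w (box k false) e \/
  sform w (box k true) e <= 0 /\ sform w (box k false) e <= 0 ->
  - (radius e)%:Z <= e ord0 k <= (radius e)%:Z.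
Proof.
move=> k0; rewrite !sform_box// expr0 expr1 mul1r mulN1r /radius.
set t := e ord0 ord0; set y := e ord0 k => H.
have := wV k; rewrite ler_norml => /andP[v1 v2].
rewrite -!(ler_int R) PoszD PoszM intrN intrD intrM -!pmulrn.
have tt : (M%:R : R) * t%:~R <= M%:R * (`|t|%N%:~R) /\
          - ((M%:R : R) * t%:~R) <= M%:R * (`|t|%N%:~R).
  rewrite -mulrN -intrN; split; apply: ler_wpM2l; rewrite ?ler0n// ler_int; lia.
rewrite -!pmulrn in tt *.
by apply/andP; split; lra.
Qed.

Lemma all_pos_cons c G e : all_pos (c :: G) e = lpos c e && all_pos G e.
Proof. by []. Qed.

Lemma all_neg_cons c G e : all_neg (c :: G) e = ~~ lpos c e && all_neg G e.
Proof. by []. Qed.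

Lemma live_eq0 s c (j : 'I_d.+1) : live s c -> (s <= j)%N -> c ord0 j = 0.
Proof. by move=> /andP[_ /forallP h] sj; apply/eqP; have := h j; rewrite sj. Qed.

Lemma live_neq0 s c : live s c -> c != 0.
Proof. by case/andP. Qed.

Lemma live_comb k a c x y : live k.+1 a -> live k.+1 c ->
  x * a ord0 k + y * c ord0 k = 0 -> x *: a + y *: c != 0 ->
  live k (x *: a + y *: c).
Proof.
move=> la lc h nz; rewrite /live nz; apply/forallP => j; apply/implyP.
rewrite leq_eqVlt => /orP[/eqP/val_inj <-|kj]; first by rewrite !mxE h.
by rewrite !mxE (live_eq0 la kj) (live_eq0 lc kj) !mulr0 addr0.
Qed.

Lemma live_descend k c : live k.+1 c -> c ord0 k = 0 -> live k c.
Proof.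
move=> lc ck; have := @live_comb k c c 1 0 lc lc.
by rewrite scale1r scale0r addr0 ck mulr0 mul0r addr0; apply => //; apply: live_neq0 lc.
Qed.

Lemma live_neg s c : live s c -> live s (- c).
Proof.
move=> lc; apply/andP; split; first by rewrite oppr_eq0 (live_neq0 lc).
by apply/forallP => j; apply/implyP => /(live_eq0 lc); rewrite mxE => ->; rewrite oppr0.
Qed.

Lemma radius_upd k e y : k != ord0 -> radius (upd e k y) = radius e.
Proof. by move=> k0; rewrite /radius upd_other// eq_sym. Qed.

Lemma all_pos_upd k G e y : all (live k) G -> all_pos G (upd e k y) = all_pos G e.
Proof.
move=> /allP hG; apply: eq_in_all => c /hG lc.
by rewrite lpos_upd// (live_eq0 lc).
Qed.

Lemma all_neg_upd k G e y : all (live k) G -> all_neg G (upd e k y) = all_neg G e.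
Proof.
move=> /allP hG; apply: eq_in_all => c /hG lc.
by rewrite lpos_upd// (live_eq0 lc).
Qed.

(** [b] gathers the conditions free of coordinate [k], while [b'] tells the order of the two ends
    and becomes a new inequality of the eliminated system. *)
Lemma boxsum_interval k q e (b b' : bool) (lo hi : int) :
  (b -> forall y, lo < y -> y <= hi -> - (radius e)%:Z <= y <= (radius e)%:Z) ->
  (b' -> lo <= hi) -> (~~ b' -> hi <= lo) ->
  \sum_(i < (radius e).*2.+1)
     q (upd e k (- (radius e)%:Z + i%:Z)) *
     [&& b, lo < - (radius e)%:Z + i%:Z & - (radius e)%:Z + i%:Z <= hi]%:R
  = (antidiff k q (upd e k hi) - antidiff k q (upd e k lo)) * (b && b')%:R.
Proof.
move=> hb hlt hge; have antiE y :
    antidiff k q (upd e k y) = sgsum (fun z => q (upd e k z)) y.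
  by rewrite /antidiff upd_same; congr sgsum; apply: funext => z; rewrite upd_upd.
case: b hb => hb; last by rewrite mulr0 big1// => i _; rewrite mulr0.
case: b' hlt hge => hlt hge; last first.
  rewrite mulr0 big1// => i _; have := hge isT => h.
  by case: andP => [[]|_]; rewrite ?mulr0//; lia.
rewrite !antiE mulr1; apply: (@sum_interval R (fun z => q (upd e k z))).
  exact: hlt.
by move=> y y1 y2; have := hb isT y y1 y2; lia.
Qed.

Definition bounded_by k l u G := forall e,
  [&& lpos l e, lpos u e & all_pos G e] || [&& ~~ lpos l e, ~~ lpos u e & all_neg G e] ->
  - (radius e)%:Z <= e ord0 k <= (radius e)%:Z.

(** With one lower and one upper bound, coordinate [k] runs over (A, B], and over (B, A] in the
    reversed system. The combination [D] of [l] and [u] free of coordinate [k] decides the order of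
    A and B, so both sums carry the same difference of antiderivatives up to sign. *)
Lemma dual_boxsum_interval k q l u G phi psi :
  k != ord0 -> quasi_poly q ->
  live k.+1 l -> live k.+1 u -> 0 < l ord0 k -> u ord0 k < 0 ->
  all (live k) G -> has_boxes k G -> bounded_by k l u G ->
  (forall e, phi e = q e * [&& lpos l e, lpos u e & all_pos G e]%:R) ->
  (forall e, psi e = q e * [&& ~~ lpos l e, ~~ lpos u e & all_neg G e]%:R) ->
  dual_pair k (boxsum k phi) (fun e => - boxsum k psi e).
Proof.
move=> k0 hq ll lu lk uk hG hB bnd hphi hpsi.
have l0 := live_neq0 ll; have u0 := live_neq0 lu.
have uk' : 0 < (- u) ord0 k by rewrite mxE oppr_gt0.
have [A [linA [hA AD AZ]]] := lpos_threshold w lk.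
have [B [linB [hB' BD BZ]]] := lpos_threshold w uk'.
have huB e y : lpos u (upd e k y) = (y <= B e).
  by rewrite leNgt -hB' lposN// negbK.
pose x := - u ord0 k; pose y := l ord0 k; pose D := x *: l + y *: u.
have x0 : 0 < x by rewrite oppr_gt0.
have posD e z : lpos l (upd e k z) -> lpos u (upd e k z) -> lpos D (upd e k z).
  by move=> pl pu; apply: lpos_comb.
have negD e z : ~~ lpos l (upd e k z) -> ~~ lpos u (upd e k z) ->
    lpos (- D) (upd e k z).
  rewrite -!lposN// => pl pu; have -> : - D = x *: (- l) + y *: (- u).
    by rewrite !scalerN opprD.
  exact: lpos_comb.
(* If [D] is zero, [l] and [u] are opposite up to positive factors. They never share a truth value,
   so both sums are empty. *)
have [D0|D0] := eqVneq D 0.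
  apply: dual_zero => e; rewrite /boxsum ?big1 ?oppr0// => i _.
    rewrite hphi; set z := - _ + _.
    have := posD e z; rewrite D0 lpos0; case: (lpos l _); case: (lpos u _) => h;
      by rewrite ?mulr0//; case: (h isT isT).
  rewrite hpsi; set z := - _ + _.
  have := negD e z; rewrite D0 oppr0 lpos0.
  case: (lpos l _); case: (lpos u _) => h;
    by rewrite ?mulr0//; case: (h isT isT).
have Dk : live k D.
  by apply: live_comb => //; rewrite /x /y; ring.
have Dupd e z : lpos D (upd e k z) = lpos D e by rewrite lpos_upd// (live_eq0 Dk).
have AB e : lpos D e -> A e <= B e.
  move=> pD; rewrite leNgt; apply/negP => BA; have := negD e (A e).
  by rewrite hA huB ltxx -ltNge BA => /(_ isT isT); rewrite lposN// Dupd pD.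
have BA e : ~~ lpos D e -> B e <= A e.
  move=> pD; rewrite leNgt; apply/negP => AB'; have := posD e (B e).
  by rewrite hA huB AB' lexx Dupd (negPf pD) => /(_ isT isT).
pose q' e := antidiff k q (upd e k (B e)) - antidiff k q (upd e k (A e)).
apply: (@dual_term k q' (D :: G)).
- have hq' := quasi_poly_antidiff k hq.
  by apply: quasi_polyB; [apply: quasi_poly_upd uk' BD BZ hq' | apply: quasi_poly_upd lk AD AZ hq'].
- by rewrite /= Dk.
- by move=> j b h; rewrite inE hB ?orbT.
- move=> e; rewrite /boxsum all_pos_cons andbC -boxsum_interval.
  + apply: eq_bigr => i _; rewrite hphi hA huB all_pos_upd//.
    by congr (_ * _%:R); case: (_ <= _); case: (_ < _); case: (all_pos _ _).
  + move=> pG z Az zB; have := bnd (upd e k z).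
    by rewrite radius_upd// upd_same hA huB all_pos_upd// Az zB pG; apply.
  + exact: AB.
  + exact: BA.
- move=> e; rewrite /boxsum all_neg_cons andbC /q' -opprB mulNr -boxsum_interval.
  + congr (- _); apply: eq_bigr => i _; rewrite hpsi hA huB all_neg_upd// -leNgt -ltNge.
    by congr (_ * _%:R); case: (_ <= _); case: (_ < _); case: (all_neg _ _).
  + move=> nG z Bz zA; have := bnd (upd e k z).
    rewrite radius_upd// upd_same hA huB all_neg_upd// -leNgt -ltNge Bz zA nG orbT.
    by apply.
  + exact: BA.
  + by rewrite negbK; apply: AB.
Qed.

Lemma lpos_proportional a c x y e :
  0 < x -> 0 < y -> x *: c = y *: a -> lpos c e = lpos a e.
Proof. by move=> x0 y0 h; rewrite -(lposZ w c e x0) h lposZ. Qed.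

(* Invariant: [l] and [u] are the strongest lower and upper bounds on
   coordinate [k] met so far, and [G] records the comparisons made. *)
Lemma dual_boxsum_merge k q G' : k != ord0 -> quasi_poly q ->
  forall l u G phi psi,
  live k.+1 l -> live k.+1 u -> 0 < l ord0 k -> u ord0 k < 0 ->
  all (live k) G -> all (live k.+1) G' -> has_boxes k (G ++ G') ->
  bounded_by k l u G ->
  (forall e, phi e = q e *
     [&& lpos l e, lpos u e & all_pos G e && all_pos G' e]%:R) ->
  (forall e, psi e = q e *
     [&& ~~ lpos l e, ~~ lpos u e & all_neg G e && all_neg G' e]%:R) ->
  dual_pair k (boxsum k phi) (fun e => - boxsum k psi e).
Proof.
move=> k0 hq; elim: G' => [|c G' ih] l u G phi psi ll lu lk uk hG hG' hB bnd hphi hpsi.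
  apply: (dual_boxsum_interval k0 hq ll lu lk uk hG) => [|//|e|e].
  - by move: hB; rewrite cats0.
  - by rewrite hphi andbT.
  - by rewrite hpsi andbT.
have {hG'} /andP[lc hG'] := hG'.
(* The boxes still required belong to coordinates below [k] and have entry 0 at [k], so discarding
   [c] loses none of them. *)
have boxes_drop G1 : c ord0 k != 0 -> (forall a, a \in G -> a \in G1) ->
    has_boxes k (G1 ++ G').
  move=> ck hsub j b hj; have := hB j b hj; rewrite !mem_cat inE.
  case/or3P => [/hsub ->//|/eqP hc|->]; last by rewrite orbT.
  move/eqP: ck; case; rewrite -hc mxE; case/andP: hj => _ jk.
  rewrite (negPf k0); case: eqP => // kj; by rewrite kj ltnn in jk.
have l0 := live_neq0 ll; have u0 := live_neq0 lu; have c0 := live_neq0 lc.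
have split_term phi1 psi1 phi2 psi2 :
    dual_pair k (boxsum k phi1) (fun e => - boxsum k psi1 e) ->
    dual_pair k (boxsum k phi2) (fun e => - boxsum k psi2 e) ->
    (forall e, phi e = phi1 e + phi2 e) -> (forall e, psi e = psi1 e + psi2 e) ->
    dual_pair k (boxsum k phi) (fun e => - boxsum k psi e).
  move=> h1 h2 e1 e2; apply: (dual_add h1 h2) => e; rewrite /boxsum.
    by rewrite -big_split; apply: eq_bigr => i _; rewrite e1.
  by rewrite -opprD -big_split; congr (- _); apply: eq_bigr => i _; rewrite e2.
have [ck|ck|ck] := ltgtP (c ord0 k) 0.
(* Here [c] is another upper bound, to be compared with [u] through [D], in which coordinate [k]
   cancels. *)
- pose x := - u ord0 k; pose y := - c ord0 k.
  have x0 : 0 < x by rewrite oppr_gt0.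
  have y0 : 0 < y by rewrite oppr_gt0.
  pose D := x *: c + (- y) *: u.
  have [D0|D0] := eqVneq D 0.
    have cu e : lpos c e = lpos u e.
      apply: (lpos_proportional _ x0 y0); apply/eqP; rewrite -subr_eq0 -(scaleNr y).
      exact/eqP.
    apply: (ih l u G) => // [|e|e].
    + by apply: boxes_drop => //; rewrite lt_eqF.
    + rewrite hphi all_pos_cons cu; congr (_ * _%:R).
      by case: (lpos l e); case: (lpos u e).
    + rewrite hpsi all_neg_cons cu; congr (_ * _%:R).
      by case: (lpos l e); case: (lpos u e).
  have Dk : live k D by apply: live_comb => //; rewrite /x /y; ring.
  have ND0 : - D != 0 by rewrite oppr_eq0.
  have DE : D = x *: c - y *: u by rewrite /D (scaleNr y).
  have sp e := @lpos_split R _ w u c D x y e u0 c0 D0 x0 y0 DE.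
  (* Where [D] is positive [u] is the stronger bound and is kept; where [- D] is positive [c]
     replaces it. The reversed system splits along the same two forms. *)
  apply: (split_term
    (fun e => q e * [&& lpos l e, lpos u e & all_pos (D :: G) e && all_pos G' e]%:R)
    (fun e => q e * [&& ~~ lpos l e, ~~ lpos u e & all_neg (D :: G) e && all_neg G' e]%:R)
    (fun e => q e * [&& lpos l e, lpos c e & all_pos (- D :: G) e && all_pos G' e]%:R)
    (fun e => q e * [&& ~~ lpos l e, ~~ lpos c e & all_neg (- D :: G) e && all_neg G' e]%:R)).
  + apply: (ih l u (D :: G)) => //; first by rewrite /= Dk.
      by apply: boxes_drop => [|a aG]; rewrite ?lt_eqF// inE aG orbT.
    move=> e /orP h; apply: bnd; apply/orP; move: h; rewrite all_pos_cons all_neg_cons.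
    by case=> /and4P[-> -> _ ->]; [left|right].
  + apply: (ih l c (- D :: G)) => //; first by rewrite /= live_neg.
      by apply: boxes_drop => [|a aG]; rewrite ?lt_eqF// inE aG orbT.
    move=> e /orP h; apply: bnd; apply/orP; move: h; rewrite all_pos_cons all_neg_cons.
    rewrite lposN// negbK; have [s1 s2] := sp e.
    case=> /and4P[-> hc hD ->]; [left|right].
      by move: s1; rewrite (negPf hD) hc andbT => ->.
    by move: s2; rewrite hD hc andbT => ->.
  + move=> e; rewrite hphi !all_pos_cons lposN// -mulrDr -natrD.
    have [s1 _] := sp e; move: s1.
    by case: (lpos u e); case: (lpos c e); case: (lpos D e); case: (lpos l e);
       case: (all_pos G e); case: (all_pos G' e).
  + move=> e; rewrite hpsi !all_neg_cons lposN// -mulrDr -natrD.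
    have [_ s1] := sp e; move: s1.
    by case: (lpos u e); case: (lpos c e); case: (lpos D e); case: (lpos l e);
       case: (all_neg G e); case: (all_neg G' e).
(* Here [c] is another lower bound, compared with [l] in the same way. *)
- pose x := l ord0 k; pose y := c ord0 k.
  pose D := x *: c + (- y) *: l.
  have [D0|D0] := eqVneq D 0.
    have cl e : lpos c e = lpos l e.
      apply: (lpos_proportional _ lk ck); apply/eqP; rewrite -subr_eq0 -(scaleNr y).
      exact/eqP.
    apply: (ih l u G) => // [|e|e].
    + by apply: boxes_drop => //; rewrite gt_eqF.
    + rewrite hphi all_pos_cons cl; congr (_ * _%:R).
      by case: (lpos l e); case: (lpos u e).
    + rewrite hpsi all_neg_cons cl; congr (_ * _%:R).
      by case: (lpos l e); case: (lpos u e).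
  have Dk : live k D by apply: live_comb => //; rewrite /x /y; ring.
  have ND0 : - D != 0 by rewrite oppr_eq0.
  have DE : D = x *: c - y *: l by rewrite /D (scaleNr y).
  have sp e := @lpos_split R _ w l c D x y e l0 c0 D0 lk ck DE.
  apply: (split_term
    (fun e => q e * [&& lpos l e, lpos u e & all_pos (D :: G) e && all_pos G' e]%:R)
    (fun e => q e * [&& ~~ lpos l e, ~~ lpos u e & all_neg (D :: G) e && all_neg G' e]%:R)
    (fun e => q e * [&& lpos c e, lpos u e & all_pos (- D :: G) e && all_pos G' e]%:R)
    (fun e => q e * [&& ~~ lpos c e, ~~ lpos u e & all_neg (- D :: G) e && all_neg G' e]%:R)).
  + apply: (ih l u (D :: G)) => //; first by rewrite /= Dk.
      by apply: boxes_drop => [|a aG]; rewrite ?gt_eqF// inE aG orbT.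
    move=> e /orP h; apply: bnd; apply/orP; move: h; rewrite all_pos_cons all_neg_cons.
    by case=> /and4P[-> -> _ ->]; [left|right].
  + apply: (ih c u (- D :: G)) => //; first by rewrite /= live_neg.
      by apply: boxes_drop => [|a aG]; rewrite ?gt_eqF// inE aG orbT.
    move=> e /orP h; apply: bnd; apply/orP; move: h; rewrite all_pos_cons all_neg_cons.
    rewrite lposN// negbK; have [s1 s2] := sp e.
    case=> /and4P[hc -> hD ->]; [left|right].
      by move: s1; rewrite (negPf hD) hc andbT => ->.
    by move: s2; rewrite hD hc andbT => ->.
  + move=> e; rewrite hphi !all_pos_cons lposN// -mulrDr -natrD.
    have [s1 _] := sp e; move: s1.
    by case: (lpos u e); case: (lpos c e); case: (lpos D e); case: (lpos l e);
       case: (all_pos G e); case: (all_pos G' e).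
  + move=> e; rewrite hpsi !all_neg_cons lposN// -mulrDr -natrD.
    have [_ s1] := sp e; move: s1.
    by case: (lpos u e); case: (lpos c e); case: (lpos D e); case: (lpos l e);
       case: (all_neg G e); case: (all_neg G' e).
(* Here [c] is free of coordinate [k] and moves to [G] unchanged. *)
- apply: (ih l u (c :: G)) => //.
  + by rewrite /= live_descend.
  + move=> j b hj; have := hB j b hj; rewrite !mem_cat !inE.
    by case/or3P => ->; rewrite ?orbT.
  + move=> e /orP h; apply: bnd; apply/orP; move: h; rewrite all_pos_cons all_neg_cons.
    by case=> /and4P[-> -> _ ->]; [left|right].
  + move=> e; rewrite hphi !all_pos_cons; congr (_ * _%:R).
    by case: (lpos c e); case: (all_pos G e); rewrite ?andbF.
  + move=> e; rewrite hpsi !all_neg_cons; congr (_ * _%:R).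
    by case: (lpos c e); case: (all_neg G e); rewrite ?andbF.
Qed.

Lemma dual_pair_boxsum k phi psi : k != ord0 -> dual_pair k.+1 phi psi ->
  dual_pair k (boxsum k phi) (fun e => - boxsum k psi e).
Proof.
move=> k0; elim => {phi psi} [phi psi h1 h2|q G phi psi hq hG hB h1 h2|
    phi1 psi1 phi2 psi2 phi psi _ ih1 _ ih2 h1 h2].
- apply: dual_zero => e; rewrite /boxsum big1 ?oppr0// => i _; by rewrite (h1, h2).
- have kn0 : (0 < k)%N by rewrite lt0n; apply: contra k0 => /eqP h; apply/eqP/val_inj.
  have inG b : box k b \in G by apply: hB; rewrite kn0 leqnn.
  have boxk b : (box k b) ord0 k = (-1) ^+ b by rewrite mxE (negPf k0) eqxx.
  have hb b := allP hG _ (inG b).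
  (* The boxes of [k] have coefficients 1 and -1 there, so they supply the initial lower and upper
     bounds. They also occur in [G], so adjoining them changes no indicator. *)
  apply: (@dual_boxsum_merge k q G k0 hq (box k false) (box k true) [::]) => //.
  + by rewrite boxk.
  + by rewrite boxk.
  + by move=> j b /andP[j0 jk]; rewrite cat0s hB// j0 ltnS ltnW.
  + move=> e h; apply: (box_le k0); case/orP: h => /and3P[p1 p2 _]; [left|right].
      by split; apply: lpos_ge0.
    by split; apply: lposN_le0.
  + move=> e; rewrite h1; congr (_ * _%:R); rewrite /=.
    have [/allP aG|//] := boolP (all_pos G e); last by rewrite !andbF.
    by rewrite !aG.
  + move=> e; rewrite h2; congr (_ * _%:R); rewrite /=.
    have [/allP aG|//] := boolP (all_neg G e); last by rewrite !andbF.
    by rewrite !aG.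
- apply: (dual_add ih1 ih2) => e; rewrite /boxsum.
    by rewrite -big_split; apply: eq_bigr => i _; rewrite h1.
  by rewrite -opprD -big_split; congr (- _); apply: eq_bigr => i _; rewrite h2.
Qed.

Local Notation axis := (delta_mx ord0 ord0 : point).

(** A remaining form is a nonzero multiple of t. For t > 0 it is positive, and for t < 0 it is not,
    under the same condition on its coefficient; the indicators become one constant absorbed into
    [q]. *)
Lemma dual_pair_axis phi psi : dual_pair 1 phi psi ->
  exists2 q, quasi_poly q & forall t : int,
    (0 < t -> phi (t *: axis) = q (t *: axis)) /\
    (t < 0 -> psi (t *: axis) = q (t *: axis)).
Proof.
elim => {phi psi} [phi psi h1 h2|q G phi psi hq hG hB h1 h2|
    phi1 psi1 phi2 psi2 phi psi _ [q1 hq1 ih1] _ [q2 hq2 ih2] h1 h2].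
- by exists (fun=> 0); [exact: quasi_poly_cst | move=> t; rewrite h1 h2].
- have sE c t : live 1 c -> sform w c (t *: axis) =
      (c ord0 ord0)%:~R * t%:~R.
    move=> lc; rewrite /sform (bigD1 ord0)//= big1 ?addr0.
      by rewrite !mxE !eqxx w0 subr0 mulr1.
    move=> j j0; rewrite (live_eq0 lc) ?mul0r// lt0n.
    by apply: contra j0 => /eqP h; apply/eqP/val_inj.
  have c0 c : live 1 c -> c ord0 ord0 != 0.
    move=> lc; have := live_neq0 lc; apply: contra => /eqP h; apply/eqP/rowP => j.
    rewrite mxE; have [->//|j0] := eqVneq j ord0; apply: (live_eq0 lc).
    by rewrite lt0n; apply: contra j0 => /eqP hj; apply/eqP/val_inj.
  have posE c (t : int) : live 1 c ->
      (0 < t -> lpos c (t *: axis) = (0 < c ord0 ord0)) /\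
      (t < 0 -> ~~ lpos c (t *: axis) = (0 < c ord0 ord0)).
    move=> lc; have cn0 := c0 c lc; rewrite lposE sE// -intrM ltr0z intr_eq0 mulf_eq0.
    rewrite (negPf cn0) /=; split => t0.
      by rewrite (gt_eqF t0) orbF pmulr_lgt0.
    by rewrite (lt_eqF t0) orbF nmulr_lgt0// -leNgt le_eqVlt eq_sym (negPf cn0).
  exists (fun e => q e * (all (fun c : point => 0 < c ord0 ord0) G)%:R).
    case: (all _ G); first by apply: quasi_poly_ext hq => e; rewrite mulr1.
    by apply: quasi_poly_ext (quasi_poly_cst _ 0) => e; rewrite mulr0.
  move=> t; split=> t0; rewrite (h1, h2); congr (_ * (nat_of_bool _)%:R); apply: eq_in_all => c cG.
    by have [+ _] := posE c t (allP hG _ cG); apply.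
  by have [_ +] := posE c t (allP hG _ cG); apply.
- exists (fun e => q1 e + q2 e); first exact: quasi_polyD.
  move=> t; have [a1 b1] := ih1 t; have [a2 b2] := ih2 t.
  by split=> t0; rewrite ?h1 ?h2 ?a1 ?a2 ?b1 ?b2.
Qed.

(** * Iterated box sums as cardinalities of finite sets of lattice points *)

Fixpoint boxsums s phi : point -> R :=
  if s is s'.+1 then boxsums s' (boxsum (inord s) phi) else phi.

Lemma boxsumsN s phi e : boxsums s (fun e => - phi e) e = - boxsums s phi e.
Proof.
elim: s phi => [//|s ih] phi /=; rewrite -ih; congr boxsums.
by apply: funext => z; rewrite -sumrN.
Qed.

Lemma dual_pair_boxsums s phi psi : (s <= d)%N -> dual_pair s.+1 phi psi ->
  dual_pair 1 (boxsums s phi) (fun e => (-1) ^+ s * boxsums s psi e).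
Proof.
elim: s phi psi => [|s ih] phi psi sd h.
  apply: (dual_add h (@dual_zero 1 _ _ (fun=> erefl) (fun=> erefl))) => e.
    by rewrite addr0.
  by rewrite addr0 mul1r.
have sE : (inord s.+1 : 'I_d.+1) = s.+1 :> nat by rewrite inordK.
rewrite -[X in dual_pair X.+1]sE in h.
have s0 : (inord s.+1 : 'I_d.+1) != ord0 by apply/eqP => /(congr1 val) /=; rewrite sE.
have := dual_pair_boxsum s0 h; rewrite [X in dual_pair X]sE => /(ih _ _ (ltnW sd)) h'.
have -> : (fun e => (-1) ^+ s.+1 * boxsums s.+1 psi e) =
  (fun e => (-1) ^+ s * boxsums s (fun e => - boxsum (inord s.+1) psi e) e) => //.
by apply: funext => e; rewrite boxsumsN exprS mulN1r mulNr mulrN.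
Qed.

(** The summations never alter coordinate 0, so everything may be compared within one slice. *)
Lemma eq_boxsums s phi psi t : (s <= d)%N ->
  (forall e, e ord0 ord0 = t -> phi e = psi e) ->
  forall e, e ord0 ord0 = t -> boxsums s phi e = boxsums s psi e.
Proof.
elim: s phi psi => [//|s ih] phi psi sd h e et; apply: ih => //; first exact: ltnW.
move=> z zt; apply: eq_bigr => i _; apply: h; rewrite upd_other//.
by apply/eqP => /(congr1 val) /=; rewrite inordK.
Qed.

Lemma boxsums_sum (I : Type) (r : seq I) s (F : I -> point -> R) e :
  boxsums s (fun z => \sum_(i <- r) F i z) e = \sum_(i <- r) boxsums s (F i) e.
Proof.
elim: s F => [//|s ih] F /=; rewrite -ih; congr boxsums.
by apply: funext => z; rewrite /boxsum exchange_big.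
Qed.

Lemma sum_indicator_interval (K : nat) (x z : int) : x <= z < x + K%:Z ->
  \sum_(i < K) (x + i%:Z == z)%:R = 1 :> R.
Proof.
move=> h; have iK : (`|(z - x)%R| < K)%N by lia.
rewrite (bigD1 (Ordinal iK))//= big1 ?addr0.
  have -> : x + `|z - x|%N = z by lia.
  by rewrite eqxx.
move=> i /eqP ii; case: eqP => // h'; case: ii; apply: val_inj => /=; lia.
Qed.

Definition coords e : 'rV[int]_d := \row_j e ord0 (lift ord0 j).

(** The indicator of a point factors over the coordinates, and each factor sums to 1 because the
    window contains that coordinate of the point. *)
Lemma boxsums_delta s phi (z : 'rV[int]_d) (t : int) : (s <= d)%N ->
  (forall j, `|z ord0 j| <= (M * `|t| + V)%N%:Z) ->
  (forall e, e ord0 ord0 = t -> phi e =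
     [forall j : 'I_d, (j < s)%N ==> (e ord0 (lift ord0 j) == z ord0 j)]%:R) ->
  forall e, e ord0 ord0 = t -> boxsums s phi e = 1.
Proof.
elim: s phi => [|s ih] phi sd hz hphi e et.
  by rewrite /= hphi//; case: forallP => // -[]; move=> j.
apply: ih => //; first exact: ltnW.
move=> {et} {}e et; pose js := Ordinal sd.
have -> : inord s.+1 = lift ord0 js :> 'I_d.+1 by apply: val_inj; rewrite /= inordK.
rewrite /boxsum; set k := lift ord0 js; set b := [forall j, _].
have -> : b%:R = b%:R *
    \sum_(i < (radius e).*2.+1) (- (radius e)%:Z + i%:Z == z ord0 js)%:R :> R.
  rewrite sum_indicator_interval ?mulr1//.
  by have := hz js; rewrite /radius et; lia.
rewrite mulr_sumr; apply: eq_bigr => i _; rewrite hphi ?upd_other// -natrM mulnb.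
congr (nat_of_bool _)%:R; apply/forallP/andP => [h|[/forallP h hs] j].
  split; last by have := h js; rewrite ltnSn upd_same.
  apply/forallP => j; apply/implyP => js'; have := h j; rewrite (ltnW _)//= upd_other//.
  by apply/eqP => /lift_inj jj; rewrite jj ltnn in js'.
apply/implyP; rewrite ltnS leq_eqVlt => /orP[/eqP jj|js'].
  by have -> : j = js by [apply: val_inj]; rewrite upd_same.
have := h j; rewrite js' upd_other//.
by apply/eqP => /lift_inj jj; rewrite jj ltnn in js'.
Qed.

Lemma boxsums_card (A : {fset 'rV[int]_d}) (Q : point -> bool) (t : int) :
  (forall z j, z \in A -> `|z ord0 j| <= (M * `|t| + V)%N%:Z) ->
  (forall e, e ord0 ord0 = t -> Q e = (coords e \in A)) ->
  forall e, e ord0 ord0 = t -> boxsums d (fun e => (Q e)%:R) e = (#|` A|%fset)%:R.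
Proof.
move=> hA hQ e et.
pose F (z : 'rV[int]_d) e : R := [forall j : 'I_d, (j < d)%N ==> (e ord0 (lift ord0 j) == z ord0 j)]%:R.
transitivity (boxsums d (fun e => \sum_(z <- A) F z e) e).
  apply: (eq_boxsums (leqnn d) _ et) => {et} {}e et; rewrite hQ//.
  have FE z : F z e = (z == coords e)%:R.
    congr (nat_of_bool _)%:R; apply/forallP/eqP => [h|-> j].
      by apply/rowP => j; have := h j; rewrite ltn_ord mxE => /eqP.
    by rewrite mxE eqxx implybT.
  under eq_bigr do rewrite FE.
  have [eA|eA] := boolP (coords e \in A).
    rewrite (bigD1_seq (coords e)) ?fset_uniq //= eqxx big1 ?addr0// => z /negPf ->//.
  rewrite big_seq big1// => z zA; case: eqP => // ze; by rewrite -ze zA in eA.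
rewrite boxsums_sum cardfE -sum1_card natr_sum.
rewrite (eq_big_seq (fun=> 1)); last first.
  by move=> z zA; apply: (@boxsums_delta d _ z t) => // j; apply: hA.
by rewrite big_seq_fsetE.
Qed.
End Elimination.

(** * The cone over the translated polytope and its lattice points *)

Section LatticePoints.
Variables (R : realType) (d m : nat) (a : 'I_m -> 'rV[int]_d) (b : 'I_m -> int).
Variable v : 'rV[R]_d.
Hypothesis a_neq0 : forall i, a i != 0.
Hypothesis generic : forall i (x : int), dotZ (a i) v != x%:~R.
Local Notation polytope := (ineqPolytope (R := R) a b).
Variable M : nat.
Hypothesis bounded : forall x, polytope x -> forall j, `|x ord0 j| < M%:R.
Variable u : 'rV[int]_d.
Hypothesis symmetric : forall x, polytope x <-> polytope (- x - intpt R u).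
Local Notation axis := (delta_mx ord0 ord0 : 'rV[int]_d.+1).

Definition homog (T : nmodType) (x : T) (r : 'rV[T]_d) : 'rV[T]_d.+1 :=
  \row_j oapp (r ord0) x (unlift ord0 j).

Lemma homog0 (T : nmodType) (x : T) r : homog x r ord0 ord0 = x.
Proof. by rewrite mxE unlift_none. Qed.

Lemma homog_lift (T : nmodType) (x : T) r j : homog x r ord0 (lift ord0 j) = r ord0 j.
Proof. by rewrite mxE liftK. Qed.

Let w : 'rV[R]_d.+1 := homog 0 v.
Let V : nat := Num.bound (\sum_j `|w ord0 j|).

Implicit Types (e : 'rV[int]_d.+1) (z : 'rV[int]_d) (x : 'rV[R]_d).

Lemma shift_le j : `|w ord0 j| <= V%:R.
Proof.
rewrite ltW// (le_lt_trans _ (archi_boundP _)) ?sumr_ge0//.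
by rewrite (bigD1 j)//= lerDl sumr_ge0.
Qed.

Definition cone_ineq i : 'rV[int]_d.+1 := homog (- b i) (a i).

(** The boxes give each spatial coordinate the bounds from which its elimination starts; by
    boundedness they hold strictly on the polytope. *)
Definition cone_ineqs : seq 'rV[int]_d.+1 :=
  [seq cone_ineq i | i <- enum 'I_m] ++
  [seq box M (lift ord0 p.1) p.2 | p <- enum {: 'I_d * bool}].

(** The point x with z = t x + v, for a dilation factor t of either sign. *)
Definition slice_point (e : 'rV[int]_d.+1) : 'rV[R]_d :=
  (e ord0 ord0)%:~R^-1 *: (intpt R (coords e) - v).

Lemma dotZD c (x y : 'rV[R]_d) : dotZ c (x + y) = dotZ c x + dotZ c y.
Proof. by rewrite -big_split; apply: eq_bigr => j _; rewrite mxE mulrDr. Qed.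

Lemma dotZZ c r (x : 'rV[R]_d) : dotZ c (r *: x) = r * dotZ c x.
Proof. by rewrite mulr_sumr; apply: eq_bigr => j _; rewrite mxE; ring. Qed.

Lemma dotZN c (x : 'rV[R]_d) : dotZ c (- x) = - dotZ c x.
Proof. by rewrite -scaleN1r dotZZ mulN1r. Qed.

Lemma dotZ_intpt c (z : 'rV[int]_d) :
  dotZ c (intpt R z) = (\sum_j c ord0 j * z ord0 j)%:~R.
Proof. by rewrite rmorph_sum; apply: eq_bigr => j _; rewrite mxE /= intrM. Qed.

Lemma sform_cone_ineq i e :
  sform w (cone_ineq i) e = dotZ (a i) (intpt R (coords e) - v)
    - (b i)%:~R * (e ord0 ord0)%:~R.
Proof.
rewrite /sform big_ord_recl !homog0 subr0 intrN mulNr addrC; congr (_ - _).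
by apply: eq_bigr => j _; rewrite !homog_lift !mxE.
Qed.

(** A zero would make (a i, v) an integer. Facet forms therefore have no ties, and strict and weak
    inequalities agree at lattice points. *)
Lemma sform_cone_ineq_neq0 i e : sform w (cone_ineq i) e != 0.
Proof.
rewrite sform_cone_ineq dotZD dotZN dotZ_intpt -intrM addrAC -intrB subr_eq0 eq_sym.
exact: generic.
Qed.

Lemma lpos_cone_ineq i e : lpos w (cone_ineq i) e = (0 < sform w (cone_ineq i) e).
Proof. by rewrite /lpos (negPf (sform_cone_ineq_neq0 _ _)) orbF. Qed.

Lemma sform_cone_ineq_slice i e : e ord0 ord0 != 0 ->
  sform w (cone_ineq i) e =
    (e ord0 ord0)%:~R * (dotZ (a i) (slice_point e) - (b i)%:~R).
Proof.
move=> e0; rewrite sform_cone_ineq dotZZ.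
by field; rewrite intr_eq0.
Qed.

Lemma sform_box_slice j (s : bool) e : e ord0 ord0 != 0 ->
  sform w (box M (lift ord0 j) s) e =
    (e ord0 ord0)%:~R * (M%:R + (-1) ^+ s * slice_point e ord0 j).
Proof.
move=> e0; rewrite sform_box ?homog0// homog_lift !mxE.
by field; rewrite intr_eq0.
Qed.

Lemma bounded_box x (s : bool) j : polytope x -> 0 < M%:R + (-1) ^+ s * x ord0 j.
Proof.
by move=> /bounded/(_ j); rewrite ltr_norml => /andP[h1 h2]; case: s; rewrite /= ?expr1 ?expr0; lra.
Qed.

Lemma all_pos_polytope e : 0 < e ord0 ord0 ->
  all_pos w cone_ineqs e = `[< polytope (slice_point e) >].
Proof.
move=> e0; have e0R : 0 < (e ord0 ord0)%:~R :> R by rewrite ltr0z.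
have en0 : e ord0 ord0 != 0 by rewrite gt_eqF.
apply/allP/asboolP => [h i|h c].
  have := h (cone_ineq i); rewrite mem_cat map_f ?mem_enum// => /(_ isT).
  by rewrite lpos_cone_ineq sform_cone_ineq_slice// pmulr_rgt0// subr_gt0 => /ltW.
rewrite mem_cat => /orP[/mapP[i _ ->]|/mapP[[j s] _ ->]].
  rewrite lpos_cone_ineq lt_neqAle eq_sym sform_cone_ineq_neq0.
  by rewrite sform_cone_ineq_slice// pmulr_rge0// subr_ge0 h.
by rewrite /lpos sform_box_slice//= pmulr_rgt0// bounded_box.
Qed.

(** Dividing by the negative dilation factor turns the reversed inequalities back into those of the
    polytope. *)
Lemma all_neg_polytope e : e ord0 ord0 < 0 ->
  all_neg w cone_ineqs e = `[< polytope (slice_point e) >].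
Proof.
move=> e0; have e0R : (e ord0 ord0)%:~R < 0 :> R by rewrite ltrz0.
have en0 : e ord0 ord0 != 0 by rewrite lt_eqF.
apply/allP/asboolP => [h i|h c].
  have := h (cone_ineq i); rewrite mem_cat map_f ?mem_enum// => /(_ isT).
  by rewrite lpos_cone_ineq sform_cone_ineq_slice// -leNgt nmulr_rle0// subr_ge0.
rewrite mem_cat => /orP[/mapP[i _ ->]|/mapP[[j s] _ ->]].
  by rewrite lpos_cone_ineq sform_cone_ineq_slice// -leNgt nmulr_rle0// subr_ge0 h.
rewrite /lpos sform_box_slice//= negb_or -leNgt.
have := bounded_box s j h => bp.
by rewrite ltW ?nmulr_rlt0//= lt_eqF// nmulr_rlt0.
Qed.

Definition slice (t : int) : set 'rV[int]_d :=
  [set z | polytope (t%:~R^-1 *: (intpt R z - v))].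

Lemma slice_bounded t z j : t != 0 -> slice t z ->
  `|z ord0 j| <= (M * `|t| + V)%N%:Z.
Proof.
move=> t0 /bounded/(_ j); rewrite !mxE normrM normfV => h.
have tR : 0 < `|t%:~R| :> R by rewrite normr_gt0 intr_eq0.
have := shift_le (lift ord0 j); rewrite homog_lift => hv.
rewrite -(ler_int R) PoszD PoszM intrD intrM intr_norm -!pmulrn natr_absz -/V.
rewrite intr_norm.
rewrite mulrC ltr_pdivrMr// in h.
have := ler_normD ((z ord0 j)%:~R - v ord0 j) (v ord0 j); rewrite subrK => h'.
by apply: le_trans h' _; rewrite lerD// ltW.
Qed.

Lemma finite_int_box (K : nat) (S : set 'rV[int]_d) :
  (forall z, S z -> forall j, `|z ord0 j| <= K%:Z) -> finite_set S.
Proof.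
move=> hS.
pose dec (f : {ffun 'I_d -> 'I_(K.*2.+1)}) : 'rV[int]_d :=
  \row_j ((f j : nat)%:Z - K%:Z).
apply: (@sub_finite_set _ _ (dec @` setT)); last first.
  by apply: finite_image; apply: finite_finset.
move=> z /hS hz; exists [ffun j => inord `|(z ord0 j + K%:Z)%R|%N] => //.
apply/rowP => j; have := hz j; rewrite [ord0]ord1 mxE ffunE => zj.
by rewrite inordK; lia.
Qed.

Lemma finite_slice t : t != 0 -> finite_set (slice t).
Proof. by move=> t0; apply: finite_int_box => z sz j; apply: slice_bounded t0 sz. Qed.

Lemma TL_slice t : (0 < t)%N -> TL a b v t = #|` fset_set (slice t%:Z)|%fset.
Proof.
move=> t0; rewrite /TL; congr (#|` fset_set _|)%fset; apply: funext => z.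
have tR : t%:R != 0 :> R by rewrite pnatr_eq0 -lt0n.
apply: propext; split => [[y [hy zy]]|h].
  by rewrite /slice /= zy -pmulrn scalerA mulVf// scale1r.
by exists (t%:R^-1 *: (intpt R z - v)); split=> //; rewrite scalerA mulfV// scale1r.
Qed.

(** From -P = P + u follows -tP + v = (tP + v) + tu, and translation by the integer vector tu is a
    bijection of lattice points. *)
Lemma card_sliceN t : t != 0 ->
  #|` fset_set (slice (- t))|%fset = #|` fset_set (slice t)|%fset.
Proof.
move=> t0; have tR : t%:~R != 0 :> R by rewrite intr_eq0.
have -> : slice (- t) = (fun z => z + t *: u) @` slice t.
  have sliceN z : slice (- t) z <-> slice t (z - t *: u).
    rewrite /slice /= symmetric.
    suff -> : - ((- t)%:~R^-1 *: (intpt R z - v)) - intpt R u =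
      t%:~R^-1 *: (intpt R (z - t *: u) - v) by [].
    by apply/rowP => j; rewrite !mxE !intrN intrD intrN intrM; field.
  apply/seteqP; split => [z /sliceN h|_ [z h <-]]; last by apply/sliceN; rewrite addrK.
  by exists (z - t *: u) => //; rewrite subrK.
rewrite fset_set_image; last exact: finite_slice.
by apply: card_imfset; apply: addIr.
Qed.

Lemma TL_quasi_poly : exists2 q : 'rV[int]_d.+1 -> R, quasi_poly q &
  forall t, (0 < t)%N -> q (t%:Z *: axis) = (TL a b v t)%:R /\
    q (- t%:Z *: axis) = (-1) ^+ d * (TL a b v t)%:R.
Proof.
have w0 : w ord0 ord0 = 0 by rewrite homog0.
have live_ineqs : all (live d.+1) cone_ineqs.
  apply/allP => c; rewrite mem_cat => hc; apply/andP; split; last first.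
    by apply/forallP => j; rewrite leqNgt ltn_ord.
  case/orP: hc => [/mapP[i _ ->]|/mapP[[j s] _ ->]].
    move: (a_neq0 i); apply: contra => /eqP/rowP h; apply/eqP/rowP => j.
    by have := h (lift ord0 j); rewrite homog_lift !mxE.
  apply/eqP => /rowP/(_ (lift ord0 j)); rewrite !mxE eqxx /=.
  by case: s.
have boxes : has_boxes M d.+1 cone_ineqs.
  move=> k s /andP[k0 _]; rewrite mem_cat; apply/orP; right.
  case: (unliftP ord0 k) => [j ->|k00]; last by rewrite k00 in k0.
  by apply/mapP; exists (j, s) => //; rewrite mem_enum.
have dp : dual_pair w M d.+1 (fun e => (all_pos w cone_ineqs e)%:R)
    (fun e => (all_neg w cone_ineqs e)%:R : R).
  by apply: (@dual_term _ _ _ _ _ (fun=> 1) _ _ _ (quasi_poly_cst _ 1)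
    live_ineqs boxes) => e; rewrite mul1r.
have axisE t : (t *: axis) ord0 ord0 = t by rewrite !mxE !eqxx mulr1.
have card_slice (Q : 'rV[int]_d.+1 -> bool) t : t != 0 ->
    (forall e, e ord0 ord0 = t -> Q e = `[< polytope (slice_point e) >]) ->
    boxsums M V d (fun e => (Q e)%:R : R) (t *: axis) =
      (#|` fset_set (slice t)|%fset)%:R.
  move=> t0 hQ; apply: (@boxsums_card _ _ _ _ _ Q t) => // [z j|e et].
    by rewrite in_fset_set; [move=> /set_mem /(slice_bounded _); apply|exact: finite_slice].
  rewrite hQ// in_fset_set; last exact: finite_slice.
  by rewrite /slice_point et.
(* Eliminating the d spatial coordinates puts the factor (-1)^d on the reversed side. *)
have [q hq qE] := dual_pair_axis w0 (dual_pair_boxsums w0 shift_le (leqnn d) dp).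
exists q => // t t0; have [h1 _] := qE t%:Z; have [_ h2] := qE (- t%:Z).
have tn0 : t%:Z != 0 by lia.
have tN0 : - t%:Z != 0 by lia.
have pos_card : boxsums M V d (fun e => (all_pos w cone_ineqs e)%:R : R) (t%:Z *: axis)
    = (TL a b v t)%:R.
  rewrite (card_slice _ _ tn0) ?TL_slice// => e et.
  by apply: all_pos_polytope; rewrite et; lia.
have neg_card : boxsums M V d (fun e => (all_neg w cone_ineqs e)%:R : R) (- t%:Z *: axis)
    = (TL a b v t)%:R.
  rewrite (card_slice _ _ tN0); first by rewrite (card_sliceN tn0) (TL_slice t0).
  by move=> e et; apply: all_neg_polytope; rewrite et; lia.
split; first by rewrite -h1 ?ltz_nat.
by rewrite -h2 ?neg_card//; lia.
Qed.

End LatticePoints.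

(** * Genericity of full-dimensional cells, and passage to constituents *)

Lemma dotZ_not_int (R : realType) (d m : nat) (a : 'I_m -> 'rV[int]_d)
    (C : set 'rV[R]_d) (c : 'rV[R]_d) i (k : int) :
  is_cell a C -> has_interior C -> C c -> a i != 0 -> dotZ (a i) c != k%:~R.
Proof.
move=> [x ->] [y [e [e0 ball]]] xc ai; apply/eqP => ck.
(* The whole cell would lie in one hyperplane; moving from an interior point along each axis then
   forces every entry of [a i] to vanish. *)
have cellE z : same_cell a x z -> dotZ (a i) z = k%:~R.
  by move=> xz; apply/(xz i k).2/(xc i k).2.
have yE : dotZ (a i) y = k%:~R by apply/cellE/ball => j; rewrite subrr normr0.
move/eqP: ai; apply; apply/rowP => j; rewrite mxE; apply/eqP.
have : dotZ (a i) (y + (e / 2) *: delta_mx ord0 j) = k%:~R.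
  apply/cellE/ball => l; rewrite !mxE addrAC subrr add0r.
  case: eqP => _; case: eqP => _ /=; rewrite ?mulr0 ?normr0// mulr1 gtr0_norm; lra.
rewrite dotZD dotZZ yE => /eqP; rewrite -subr_eq0 addrAC subrr add0r.
rewrite mulf_eq0 gt_eqF ?divr_gt0//= /dotZ (bigD1 j)//= big1 => [|l lj].
  by rewrite !mxE !eqxx mulr1 addr0 intr_eq0.
by rewrite mxE (negPf lj) andbF mulr0.
Qed.

Lemma poly_eq_on_progression (R : realType) (p r : {poly R}) (x0 x1 : int) :
  x1 != 0 -> (forall s : nat, p.[(x0 + s%:Z * x1)%:~R] = r.[(x0 + s%:Z * x1)%:~R]) ->
  p = r.
Proof.
move=> x10 h; apply/eqP; rewrite -subr_eq0; apply/negPn/negP => pr.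
pose rs : seq R := [seq (x0 + s%:Z * x1)%:~R | s <- iota 0 (size (p - r))].
have := @max_poly_roots _ _ rs pr; rewrite size_map size_iota ltnn.
case/(_ _ _)/negP => //.
  by apply/allP => _ /mapP[s _ ->]; rewrite rootE hornerD hornerN h subrr.
rewrite map_inj_uniq ?iota_uniq// => s s' /intr_inj /addrI /mulIf.
by move/(_ x10) => [].
Qed.

(** The difference of [q] and [f] is a quasi-polynomial vanishing far out on a progression inside
    the class of [k], hence also at its negative members. *)
Lemma quasi_poly_eq_poly (R : realType) (n : nat) (q : 'rV[int]_n.+1 -> R)
    (f : {poly R}) (N : nat) (k : int) : (0 < N)%N -> quasi_poly q ->
  (forall t, (0 < t)%N -> (t%:Z = k %[mod N%:Z])%Z ->
     q (t%:Z *: delta_mx ord0 ord0) = f.[t%:R]) ->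
  exists2 W : nat, (0 < W)%N & forall s : int,
    q ((k + s * (W * N)%N) *: delta_mx ord0 ord0) = f.[(k + s * (W * N)%N)%:~R].
Proof.
move=> N0 [W [D [W0 hq]]] hf; exists `|W|%N; first by rewrite absz_gt0 gt_eqF.
pose ax : 'rV[int]_n.+1 := delta_mx ord0 ord0.
pose h e := q e - f.[(e ord0 ord0)%:~R].
have hh : dnilp W (maxn D (size f)) h.
  apply: dnilpB; first by apply: dnilp_leq hq; rewrite leq_maxl.
  by apply: dnilp_leq (dnilp_poly f ord0 W); rewrite leq_maxr.
have WN (s : int) : (k + s * (`|W| * N)%N) *: ax = k *: ax + (s * W) *: (N%:Z *: ax).
  by rewrite scalerA -scalerDl PoszM gtz0_abs// mulrA.
have axE t : (t *: ax) ord0 ord0 = t by rewrite !mxE !eqxx mulr1.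
have eqh (s : int) : h ((k + s * (`|W| * N)%N) *: ax) = 0.
  (* From this threshold on, k + s W N is positive because W N >= 1. *)
  rewrite WN; apply: (dnilp_line_eq0 (T := `|k| + 1) hh) => {}s ks.
  rewrite -WN /h axE; set t := k + _.
  have WN0 : (0 < `|W| * N)%N by rewrite muln_gt0 N0 absz_gt0 gt_eqF.
  have t0 : 0 < t by rewrite /t; nia.
  have tE : t = `|t|%N by rewrite gtz0_abs.
  have := hf `|t|%N; rewrite -tE -[f.[_]]/(f.[`|t|%N%:~R]) -tE => -> //.
  - by rewrite subrr.
  - by rewrite absz_gt0 gt_eqF.
  - by rewrite /t PoszM mulrA addrC modzMDl.
by move=> s; apply/eqP; rewrite -subr_eq0; apply/eqP; have := eqh s; rewrite /h axE.
Qed.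

Unset Implicit Arguments.

Theorem mainTheorem9 (R : realType) (d m : nat)
    (a : 'I_m -> 'rV[int]_d) (b : 'I_m -> int)
    (hprim : forall i, primitive_vec (a i) (b i))
    (hirr : irredundant R a b)
    (hpol : d_polytope (ineqPolytope (R:=R) a b))
    (u : 'rV[int]_d)
    (hsym : [set - x | x in ineqPolytope (R:=R) a b] = [set x + intpt R u | x in ineqPolytope (R:=R) a b])
    (C : set 'rV[R]_d) (hC : is_cell a C) (hCd : has_interior C)
    (v : 'rV[R]_d) (hv : exists c z, C c /\ v = c + intpt R z)
    (N : nat) (hN : qpoly_period R (TL a b v) N)
    (k : int) (f g : {poly R})
    (hf : constituent (TL a b v) N k f)
    (hg : constituent (TL a b v) N (- k) g) :
  forall x : R, f.[x] = (-1) ^+ d * g.[- x].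
Proof.
have [[M0 hM0] [p0 [e0 [e0_gt0 ball0]]]] := hpol.
have Pp0 : ineqPolytope (R := R) a b p0 by apply: ball0 => j; rewrite subrr normr0.
(* An inequality with zero normal holds everywhere or nowhere, but it holds at [p0] and irredundancy
   provides a point violating it. *)
have a_neq0 i : a i != 0.
  apply/eqP => ai; have [x [_]] := hirr i.
  have dot0 y : dotZ (R := R) (a i) y = 0.
    by apply: big1 => j _; rewrite ai mxE mul0r.
  by have := Pp0 i; rewrite !dot0 => h /(le_lt_trans h); rewrite ltxx.
have generic i (x : int) : dotZ (a i) v != x%:~R.
  have [c [z [Cc ->]]] := hv; rewrite dotZD dotZ_intpt; set y := (\sum_j _).
  apply/eqP => cx; have := dotZ_not_int (x - y) hC hCd Cc (a_neq0 i).
  by rewrite intrB -cx addrK eqxx.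
have bounded x : ineqPolytope (R := R) a b x ->
    forall j, `|x ord0 j| < (Num.bound M0)%:R.
  move=> Px j; apply: le_lt_trans (hM0 x Px j) (archi_boundP _).
  exact: le_trans (normr_ge0 _) (hM0 x Px j).
have symmetric1 x : ineqPolytope (R := R) a b x ->
    ineqPolytope (R := R) a b (- x - intpt R u).
  move=> Px; have : [set - x | x in ineqPolytope (R := R) a b] (- x) by exists x.
  by rewrite hsym => -[y Py <-]; rewrite addrK.
have symmetric x : ineqPolytope (R := R) a b x <->
    ineqPolytope (R := R) a b (- x - intpt R u).
  by split=> [/symmetric1//|/symmetric1]; rewrite opprB opprK addrC addrA addNr add0r.
have [q hq qE] := TL_quasi_poly a_neq0 generic bounded symmetric.
have N0 : (0 < N)%N by case: hN.
have [W W0 fE] : exists2 W : nat, (0 < W)%N & forall s : int,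
    q ((k + s * (W * N)%N) *: delta_mx ord0 ord0) = f.[(k + s * (W * N)%N)%:~R].
  apply: quasi_poly_eq_poly => // t t0 tk; rewrite (hf t t0 tk).
  exact: (qE t t0).1.
have WN0 : (0 < W * N)%N by rewrite muln_gt0 W0.
suff -> : f = (-1) ^+ d *: (g \Po - 'X).
  by move=> x; rewrite hornerZ horner_comp hornerN hornerX.
(* The comparison takes place at negative members y of k + W N Z. There f(y) is the value of [q],
   namely (-1)^d times the count at |y|. *)
apply: (@poly_eq_on_progression _ _ _ (k - (`|k| + 1) * (W * N)%N) (- (W * N)%N%:Z)).
  by rewrite oppr_eq0; lia.
move=> s; set y := k - _ + _.
have yE : y = k + (- (`|k| + 1 + s%:Z)) * (W * N)%N by rewrite /y; ring.
have y0 : y < 0 by rewrite yE; nia.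
have yt : y = - `|y|%N%:Z by lia.
have t0 : (0 < `|y|)%N by lia.
rewrite hornerZ horner_comp hornerN hornerX.
have -> : - y%:~R = `|y|%N%:R :> R by rewrite {1}yt intrN opprK.
rewrite [in LHS]yE -fE -yE [in LHS]yt (qE _ t0).2; congr (_ * _).
rewrite hg//.
(* Since |y| = -y lies in the class of -k, the count there is a value of [g]. *)
have -> : `|y|%N%:Z = (`|k| + 1 + s%:Z) * W * N%:Z + - k.
  by rewrite ltz0_abs// yE PoszM; ring.
by rewrite modzMDl.
Qed.
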